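(* Assume $\theta_n>0$ for all $n$, that there are constants $c_j$ with $\sum_{j\ge1}\frac{c_j}{j}<\infty$ such that $\frac{\theta_{n-j}\theta_j}{\theta_n}<c_j$ for all $n$ and all $1\le j\le\frac n2$, and that $\frac{\theta_{n+1}}{\theta_n}\to1$ as $n\to\infty$. Then $\sum_{j\ge0}h_j<\infty$, and for every fixed integer $m\ge0$, \[ \lim_{n\to\infty}\mathbb{P}_n(L_1=n-m)=\frac{h_m}{\sum_{j\ge0}h_j}. \] Moreover, $R_1,R_2,R_3,\dots$ converge weakly to independent Poisson random variables with respective means $\theta_1,\frac{\theta_2}2,\frac{\theta_3}3,\dots$, and $K-1$ converges in distribution to a Poisson random variable with mean $\sum_{j\ge1}\frac{\theta_j}j$.
   Context: For $\sigma\in\mathcal{S}_n$ (permutations of $\{1,\dots,n\}$), $R_j(\sigma)$ is the number of cycles of length $j$, $L_1(\sigma)$ the length of the cycle containing $1$, $K(\sigma)=\sum_jR_j(\sigma)$. Given parameters $\theta_j\ge0$, $h_0=1$, $h_n=\frac1{n!}\sum_{\sigma\in\mathcal{S}_n}\prod_j\theta_j^{R_j(\sigma)}$, and $\mathbb{P}_n(\sigma)=\frac1{n!h_n}\prod_j\theta_j^{R_j(\sigma)}$. *)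

(* Defs.v *)
(* Stdlib Reals (real-valued weights, limits, exp) combined with
   MathComp (permutations 'S_n, porbits, finite types).
   NB: mathcomp rebinds the %R delimiter to ring_scope, so real arithmetic is
   written with the explicit Stdlib functions Rplus, Rmult, Rdiv, ... *)
From Stdlib Require Import Reals.
From mathcomp Require Import all_boot all_fingroup.

Set Implicit Arguments.
Unset Strict Implicit.
Unset Printing Implicit Defensive.

(* The ground set {1,...,n} is represented by 'I_n = {0,...,n-1}; the element 1
   of the paper corresponds to ord0. *)

Definition Rcyc (n j : nat) (s : 'S_n) : nat :=
  #|[set c in porbits s | #|c| == j]|.

Definition Kcyc (n : nat) (s : 'S_n) : nat := #|porbits s|.

Definition L1 (n : nat) : 'S_n -> nat :=
  match n as k return 'S_k -> nat with
  | 0 => fun _ => 0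
  | k.+1 => fun s => #|porbit s ord0|
  end.

Definition Rsum_seq (T : Type) (l : seq T) (f : T -> R) : R :=
  foldr (fun x acc => Rplus (f x) acc) R0 l.
Definition Rprod_seq (T : Type) (l : seq T) (f : T -> R) : R :=
  foldr (fun x acc => Rmult (f x) acc) R1 l.

(* prod_j theta_j^{R_j(sigma)}  (only j = 1..n can have R_j > 0). *)
Definition weight (theta : nat -> R) (n : nat) (s : 'S_n) : R :=
  Rprod_seq (iota 1 n) (fun j => pow (theta j) (Rcyc j s)).

Definition hseq (theta : nat -> R) (n : nat) : R :=
  Rdiv (Rsum_seq (enum 'S_n) (@weight theta n)) (INR n`!).

Definition Pn (theta : nat -> R) (n : nat) (A : pred 'S_n) : R :=
  Rdiv (Rsum_seq [seq s <- enum 'S_n | A s] (@weight theta n))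
       (Rmult (INR n`!) (hseq theta n)).

Definition poisson (lambda : R) (k : nat) : R :=
  Rdiv (Rmult (exp (Ropp lambda)) (pow lambda k)) (INR k`!).

Definition Rvec_event (n b : nat) (k : nat -> nat) : pred 'S_n :=
  fun s => [forall j : 'I_b, Rcyc j.+1 s == k j.+1].

(* Main.v *)
(* Removing the cycle of 1 gives n h_n = sum_(m < n) theta_(n-m) h_m, and the
   analogous recurrences for sums restricted to prescribed cycle counts.  With
   p_j = theta_j / j these identify the mass of permutations with k cycles as
   p^{*k} / k!, and the mass with prescribed numbers k_j of j-cycles, j <= b, as
   prod_j p_j^(k_j) / k_j! times the mass of permutations without short cycles.
   Summing over n gives sum_n h_n = exp (sum_j p_j).  The hypothesis on theta
   makes p subexponential: p * p <= D p, hence p^{*k} <= D^(k-1) p and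
   h_n <= e^D p_n for n >= 1.  With this domination, Tannery's theorem applied
   to the recurrence, split at m = n / 2, gives n f_n / theta_n -> sum_m g_m
   whenever n f_n = sum_m theta_(n-m) g_m and 0 <= g <= h.  All three limits are
   ratios of such asymptotics. *)
Require Import Defs.
From Stdlib Require Import Reals.
From Coquelicot Require Import Hierarchy Rbar Lim_seq Series PSeries ElemFct.
From mathcomp Require Import all_boot all_order all_fingroup all_algebra boolp Rstruct.
From mathcomp Require Import ring lra zify.

Set Implicit Arguments.
Unset Strict Implicit.
Unset Printing Implicit Defensive.

Import Order.TTheory GRing.Theory Num.Theory.

Local Open Scope nat_scope.

(** * Inserting a point into a permutation *)

Lemma porbit_step (T : finType) (s : {perm T}) (x y : T) :
  y \in porbit s x -> s y \in porbit s x.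
Proof. by rewrite -!eq_porbit_mem => /eqP <-; apply/eqP; apply: (porbit_perm s 1). Qed.

(** By finiteness every point of the cycle is a forward iterate of [x], so induction needs no step
    along the inverse. *)
Lemma porbit_ind (T : finType) (s : {perm T}) (x : T) (P : T -> Prop) :
  P x -> (forall y, y \in porbit s x -> P y -> P (s y)) ->
  forall y, y \in porbit s x -> P y.
Proof.
move=> P0 PS y /porbitP [i ->]; elim: i => [|i IH]; first by rewrite perm1.
by rewrite expgSr permM; apply: PS => //; apply: mem_porbit.
Qed.

(** * Cycle types and the cycles avoiding a marked point *)

Definition cycle_type (n : nat) (s : 'S_n) : nat -> nat := fun j => Rcyc j s.

(** The counts left after deleting the cycle of [x], read inside [s] itself, so that no permutation
    of the complement has to be built. *)
Definition rest_type (n : nat) (x : 'I_n) (s : 'S_n) : nat -> nat :=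
  fun j => #|[set c in porbits s | (#|c| == j) && (x \notin c)]|.

Lemma mem_porbits (T : finType) (s : {perm T}) (x : T) : porbit s x \in porbits s.
Proof. by apply/imsetP; exists x. Qed.

Lemma porbits_mem (T : finType) (s : {perm T}) c (x : T) :
  c \in porbits s -> x \in c -> c = porbit s x.
Proof. by case/imsetP=> y _ ->; rewrite -eq_porbit_mem => /eqP. Qed.

Definition incr (l : nat) (r : nat -> nat) : nat -> nat := fun j => (j == l) + r j.

Lemma cycle_type_rest (n : nat) (x : 'I_n) (s : 'S_n) j :
  cycle_type s j = incr #|porbit s x| (rest_type x s) j.
Proof.
rewrite /cycle_type /incr /Rcyc /rest_type.
rewrite (cardsD1 (porbit s x)) inE mem_porbits /= eq_sym; congr (_ + _).
apply: eq_card => c; rewrite !inE [RHS]andbCA [RHS]andbC -andbA.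
case Hc: (c \in porbits s) => //=; last by rewrite !andbF.
congr (_ && _); apply: (congr1 negb); apply/eqP/idP => [->|]; first exact: porbit_id.
exact: porbits_mem.
Qed.

(* The new point [ord0] is inserted just before [p.1] in the cycle of [p.1], or
   as a fixed point when [p.1] is [ord0]. *)
Definition insert_perm (n : nat) (p : 'I_n.+1 * 'S_n) : 'S_n.+1 :=
  (lift0_perm p.2 * tperm ord0 p.1)%g.

(** The image of [ord0] recovers [p.1], then the other images recover [p.2]; equal cardinalities
    turn injectivity into bijectivity. *)
Lemma insert_perm_bij (n : nat) : bijective (@insert_perm n).
Proof.
apply: inj_card_bij; last by rewrite card_prod card_ord !card_Sn factS.
move=> [i s] [j t] /=; rewrite /insert_perm /= => E.
have ij : i = j.
  have := congr1 (fun u : 'S_n.+1 => u ord0) E.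
  by rewrite !permM !lift0_perm0 !tpermL.
move: E; rewrite {}ij => /mulIg E; congr (_, _); apply/permP => k.
have := congr1 (fun u : 'S_n.+1 => u (lift ord0 k)) E.
by rewrite !lift0_perm_lift => /lift_inj.
Qed.

Section Insert.
Variables (n : nat) (s : 'S_n).

Section Fixed.
Let t := insert_perm (ord0, s).
Lemma insert0_perm0 : t ord0 = ord0.
Proof. by rewrite /t permM /= lift0_perm0 tperm1 perm1. Qed.
Lemma insert0_perm_lift y : t (lift ord0 y) = lift ord0 (s y).
Proof. by rewrite /t permM /= lift0_perm_lift tperm1 perm1. Qed.
End Fixed.

Section Cycle.
Variable k : 'I_n.
Let t := insert_perm (lift ord0 k, s).
Lemma insert_perm0 : t ord0 = lift ord0 k.
Proof. by rewrite /t permM /= lift0_perm0 tpermL. Qed.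
Lemma insert_perm_lift y : s y != k -> t (lift ord0 y) = lift ord0 (s y).
Proof.
move=> E; rewrite /t permM /= lift0_perm_lift tpermD //.
by rewrite (inj_eq (@lift_inj _ _)) eq_sym.
Qed.
End Cycle.
End Insert.

Lemma porbit_lift (n : nat) (s : 'S_n) (t : 'S_n.+1) (y : 'I_n) :
  (forall z, z \in porbit s y -> t (lift ord0 z) = lift ord0 (s z)) ->
  porbit t (lift ord0 y) = lift ord0 @: porbit s y.
Proof.
move=> H; apply/setP => w; apply/idP/imsetP => [|[z zy ->{w}]].
  move: w; apply: porbit_ind; first by exists y => //; apply: porbit_id.
  move=> w _ [z zy ->]; rewrite H //; exists (s z) => //; exact: porbit_step.
move: z zy; apply: porbit_ind; first exact: porbit_id.
by move=> z zy IH; rewrite -H //; apply: porbit_step.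
Qed.

(** Common to both kinds of insertion: [A] collects the old points that join the cycle of [ord0], so
    it is empty for a new fixed point and the cycle of [k] otherwise. All other cycles are
    copied. *)
Lemma rest_type_lift (n : nat) (s : 'S_n) (t : 'S_n.+1) (A : {set 'I_n}) j :
  (forall y, y \notin A -> porbit t (lift ord0 y) = lift ord0 @: porbit s y) ->
  porbit t ord0 = ord0 |: lift ord0 @: A ->
  rest_type ord0 t j =
  #|[set c in porbits s | (#|c| == j) && [disjoint A & c]]|.
Proof.
move=> Hoff H0; rewrite /rest_type.
have linj : injective (fun c : {set 'I_n} => [set lift ord0 x | x in c]).
  exact/imset_inj/lift_inj.
rewrite -(card_imset _ linj); apply: eq_card => c.
rewrite !inE; apply/idP/imsetP.
  case/andP=> /imsetP [w _ ->] /andP [/eqP cj n0].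
  have : w \notin porbit t ord0 by rewrite porbit_sym.
  rewrite H0 !inE negb_or => /andP [w0 wA].
  have [y Ey] : exists y, w = lift ord0 y.
    by case: (unliftP ord0 w) w0 => [y -> _|->]; [exists y | rewrite eqxx].
  have yA : y \notin A.
    by apply: contra wA => yA; rewrite Ey; apply: imset_f.
  exists (porbit s y); last by rewrite Ey Hoff.
  rewrite inE mem_porbits -cj Ey (Hoff _ yA) card_imset ?eqxx /=; last exact: lift_inj.
  rewrite disjoint_sym disjoint_subset; apply/subsetP => z zy; rewrite inE /=.
  apply: contra n0 => zA.
  rewrite porbit_sym -eq_porbit_mem Ey.
  have: lift ord0 z \in porbit t ord0 by rewrite H0 !inE imset_f ?orbT.
  rewrite -eq_porbit_mem => /eqP <-.
  by rewrite eq_sym eq_porbit_mem (Hoff _ yA) imset_f.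
case=> c'; rewrite inE => /and3P [/imsetP [y _ ->] /eqP cj dA] ->.
have yA : y \notin A.
  by move: dA; rewrite disjoint_sym => /disjointFr -> //; apply: porbit_id.
rewrite -(Hoff _ yA) mem_porbits (Hoff _ yA) card_imset ?cj ?eqxx /=; last exact: lift_inj.
by apply/imsetP => -[z _] /eqP; rewrite (negPf (neq_lift _ _)).
Qed.

Lemma insert_fixed_porbit (n : nat) (s : 'S_n) :
  #|porbit (insert_perm (ord0, s)) ord0| = 1 /\
  rest_type ord0 (insert_perm (ord0, s)) =1 cycle_type s.
Proof.
set t := insert_perm _.
have H0 : porbit t ord0 = [set ord0].
  apply/setP => w; rewrite inE; apply/idP/eqP => [|->]; last exact: porbit_id.
  move: w; apply: porbit_ind => // y _ ->; exact: insert0_perm0.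
rewrite H0 cards1; split=> // j.
rewrite (@rest_type_lift _ s t set0) ?H0 ?imset0 ?setU0 //.
  apply: eq_card => c; rewrite !inE; case: (c \in _) => //=.
  have -> : [disjoint set0 & c] by rewrite -setI_eq0 set0I.
  by rewrite andbT.
by move=> y _; apply: porbit_lift => z _; apply: insert0_perm_lift.
Qed.

Lemma insert_cycle_porbit (n : nat) (s : 'S_n) (k : 'I_n) :
  #|porbit (insert_perm (lift ord0 k, s)) ord0| = #|porbit s k|.+1 /\
  rest_type ord0 (insert_perm (lift ord0 k, s)) =1 rest_type k s.
Proof.
set t := insert_perm _.
have Hoff y : y \notin porbit s k ->
    porbit t (lift ord0 y) = lift ord0 @: porbit s y.
  move=> yk; apply: porbit_lift => z zy; apply: insert_perm_lift.
  (* Only the point that [s] maps to [k] is rerouted, and it lies in the cycle of [k]. *)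
  apply: contra yk => /eqP E; rewrite porbit_sym -E; exact: porbit_step.
have H0 : porbit t ord0 = ord0 |: lift ord0 @: porbit s k.
  apply/setP => w; rewrite !inE; apply/idP/orP.
    move=> w0; case: (unliftP ord0 w) w0 => [y ->|->]; last by left.
    move=> yt; right; apply: imset_f; case: (boolP (y \in porbit s k)) => // /Hoff E.
    move: yt; rewrite porbit_sym E => /imsetP [z _] /eqP.
    by rewrite (negPf (neq_lift _ _)).
  case=> [/eqP ->|/imsetP [z zk ->]]; first exact: porbit_id.
  move: z zk; apply: porbit_ind.
    rewrite -(insert_perm0 s); apply: porbit_step; exact: porbit_id.
  (* If [s z = k], the insertion breaks the old step, but [lift ord0 k] is still reached, as the
     image of [ord0]. *)
  move=> z zk IH; case: (eqVneq (s z) k) => [->|E].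
    rewrite -(insert_perm0 s); apply: porbit_step; exact: porbit_id.
  by rewrite -(insert_perm_lift E); apply: porbit_step.
split.
  rewrite H0 cardsU1 card_imset ?add1n; last exact: lift_inj.
  suff -> : ord0 \notin [set lift ord0 x | x in porbit s k] by [].
  by apply/imsetP => -[z _] /eqP; rewrite (negPf (neq_lift _ _)).
move=> j; rewrite (rest_type_lift _ Hoff H0).
apply: eq_card => c; rewrite !inE; case Hc: (c \in _) => //=; congr (_ && _).
case/imsetP: Hc => y _ ->.
apply/idP/idP => [/disjointFr D|D]; first by rewrite D // porbit_id.
rewrite disjoint_subset; apply/subsetP => z zk; rewrite inE /=.
apply: contra D => zy.
by move: zk zy; rewrite -!eq_porbit_mem eq_sym => /eqP ->.
Qed.

(** * Sums over permutations with a marked point *)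

Lemma porbit_conj (T : finType) (s t : {perm T}) (x : T) :
  porbit (s ^ t)%g (t x) = t @: porbit s x.
Proof.
apply/setP => w; apply/idP/imsetP => [|[z zx ->{w}]].
  move: w; apply: porbit_ind; first by exists x => //; apply: porbit_id.
  move=> w _ [z zx ->]; rewrite permJ; exists (s z) => //; exact: porbit_step.
move: z zx; apply: porbit_ind; first exact: porbit_id.
by move=> z zx IH; rewrite -permJ; apply: porbit_step.
Qed.

Lemma rest_type_conj (n : nat) (s t : 'S_n) (x : 'I_n) :
  rest_type (t x) (s ^ t)%g =1 rest_type x s.
Proof.
move=> j; rewrite /rest_type.
have tinj : injective (fun c : {set 'I_n} => t @: c) by exact/imset_inj/perm_inj.
rewrite -[RHS](card_imset _ tinj); apply: eq_card => c; rewrite !inE.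
apply/idP/imsetP.
  case/andP=> /imsetP [w _ ->] /andP [/eqP cj nx].
  have Ew : porbit (s ^ t)%g w = t @: porbit s ((t^-1)%g w).
    by rewrite -porbit_conj permKV.
  exists (porbit s ((t^-1)%g w)) => //.
  rewrite inE mem_porbits -cj Ew card_imset ?eqxx /=; last exact: perm_inj.
  by apply: contra nx => nx; rewrite Ew imset_f.
case=> c'; rewrite inE => /and3P [/imsetP [y _ ->] /eqP cj nx] ->.
rewrite -porbit_conj mem_porbits porbit_conj card_imset; last exact: perm_inj.
rewrite cj eqxx /=; apply: contra nx => /imsetP [z zy /perm_inj ->] //.
Qed.

Section Sums.
Local Open Scope ring_scope.
Variable K : numFieldType.
Implicit Types (F : (nat -> nat) -> K) (Phi : nat -> (nat -> nat) -> K).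

(** Keeping the marked length and the remaining counts as separate arguments lets points be peeled
    off the marked cycle one at a time. *)
Definition marked_sum (n : nat) (x : 'I_n) Phi : K :=
  \sum_(s : 'S_n) Phi #|porbit s x| (rest_type x s).

Definition type_mean (n : nat) F : K :=
  (\sum_(s : 'S_n) F (cycle_type s)) / n`!%:R.

(** Conjugation by the transposition of [x] and [y] moves the mark and preserves all cycle
    lengths. *)
Lemma marked_sum_indep n (x y : 'I_n) Phi : marked_sum x Phi = marked_sum y Phi.
Proof.
rewrite /marked_sum.
rewrite [RHS](reindex_inj (@conjg_inj _ (tperm x y))); apply: eq_bigr => s _.
rewrite -{2 3}(tpermL x y) porbit_conj card_imset; last exact: perm_inj.
by congr (Phi _ _); apply/funext => j; rewrite rest_type_conj.
Qed.

(** Erasing [ord0] either removes a fixed point or shortens by one the cycle through its image [k],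
    which becomes the new mark. *)
Lemma marked_sum_rec n Phi :
  marked_sum (@ord0 n) Phi = \sum_(s : 'S_n) Phi 1%N (cycle_type s)
    + \sum_(k < n) marked_sum k (fun l => Phi l.+1).
Proof.
rewrite /marked_sum.
rewrite (reindex _ (onW_bij _ (@insert_perm_bij n))) /=.
rewrite -(pair_big predT predT (fun i s => Phi #|porbit (insert_perm (i, s)) ord0|
   (rest_type ord0 (insert_perm (i, s))))) /= big_ord_recl.
congr (_ + _); last apply: eq_bigr => k _; apply: eq_bigr => s _.
  have [-> /funext ->] := insert_fixed_porbit s; congr (Phi _ _).
have [-> /funext ->] := insert_cycle_porbit s k; congr (Phi _ _).
Qed.

(* The factor [n^_l] counting the cycles of length [l.+1] through the marked
   point is absorbed by the normalisation with factorials. *)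
Lemma marked_sum_unfold n Phi :
  marked_sum (@ord0 n) Phi / n`!%:R =
  \sum_(m < n.+1) type_mean m (Phi (n.+1 - m)%N).
Proof.
elim: n Phi => [|n IH] Phi.
  by rewrite marked_sum_rec !big_ord0 addr0 big_ord_recl big_ord0 addr0.
rewrite marked_sum_rec mulrDl [RHS]big_ord_recr /= subSn // subnn [LHS]addrC; congr (_ + _).
under eq_bigr => k _ do rewrite (marked_sum_indep k ord0).
rewrite sumr_const card_ord factS natrM invfM mulrA -[X in X / _ / _]mulr_natr.
rewrite mulfK ?pnatr_eq0 // IH; apply: eq_bigr => m _; congr type_mean.
by rewrite -subSn // ltnW // ltn_ord.
Qed.

(** The master recurrence: mark [ord0] and remove its cycle, with [m] the number of points off that
    cycle. Since [F] is arbitrary, weights and constraints on cycle counts are handled alike. *)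
Lemma type_mean_unfold n F :
  n.+1%:R * type_mean n.+1 F =
  \sum_(m < n.+1) type_mean m (fun r => F (incr (n.+1 - m) r)).
Proof.
rewrite -(marked_sum_unfold n (fun l r => F (incr l r))) /type_mean factS natrM.
rewrite invfM mulrCA mulVKf ?pnatr_eq0 //; congr (_ / _).
by apply: eq_bigr => s _; congr F; apply/funext => j; rewrite (cycle_type_rest ord0).
Qed.

(** An indicator in the marked length selects the single summand [m = n.+1 - l] of the unfolded
    sum. *)
Lemma type_mean_marked n l (F : (nat -> nat) -> K) : (0 < l <= n.+1)%N ->
  (\sum_(s : 'S_n.+1 | #|porbit s ord0| == l) F (cycle_type s)) / n`!%:R
  = type_mean (n.+1 - l) (fun r => F (incr l r)).
Proof.
move=> /andP [l0 ln].
have := marked_sum_unfold n (fun l' r => if l' == l then F (incr l r) else 0).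
rewrite /marked_sum -big_mkcond /=.
under eq_bigr => s /eqP E.
  have -> : incr l (rest_type ord0 s) = cycle_type s.
    by apply/funext => j; rewrite (cycle_type_rest ord0) E.
  over.
move=> ->.
have ln' : (n.+1 - l < n.+1)%N by rewrite ltn_subrL l0.
rewrite (bigD1 (Ordinal ln')) //= subKn // eqxx big1 ?addr0 // => m.
rewrite -val_eqE /= => mE; rewrite /type_mean big1 ?mul0r // => s _.
case: eqP => // E; case/eqP: mE; rewrite -E subKn // ltnW //.
Qed.
End Sums.

(** * Weighted sums and their generating functions *)

Lemma cycle_type_eq0 (n : nat) (s : 'S_n) j : n < j -> cycle_type s j = 0.
Proof.
move=> nj; apply/eqP; rewrite /cycle_type /Rcyc cards_eq0; apply/eqP/setP => c.
rewrite !inE; apply/negP => /andP [_ /eqP cj].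
by have := max_card c; rewrite cj card_ord leqNgt nj.
Qed.

Lemma cycle_type0 (n : nat) (s : 'S_n) : cycle_type s 0 = 0.
Proof.
apply/eqP; rewrite /cycle_type /Rcyc cards_eq0; apply/eqP/setP => c.
rewrite !inE; apply/negP => /andP [/imsetP [x _ ->]].
by rewrite (negPf (card_porbit_neq0 _ _)).
Qed.

Lemma Kcyc_cycle_type (N n : nat) (s : 'S_n) : n <= N ->
  Kcyc s = \sum_(1 <= j < N.+1) cycle_type s j.
Proof.
move=> nN; rewrite /Kcyc -sum1_card.
under [RHS]eq_bigr => j _ do rewrite /cycle_type /Rcyc -sum1dep_card big_mkcondr /=.
rewrite exchange_big /=; apply: eq_bigr => c /imsetP [x _ ->].
have le : #|porbit s x| <= N by rewrite (leq_trans (max_card _)) // card_ord.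
have gt : 0 < #|porbit s x| by rewrite lt0n card_porbit_neq0.
rewrite (bigD1_seq #|porbit s x|) ?iota_uniq ?mem_index_iota /= ?gt ?eqxx //.
by rewrite big1 ?addn0 // => j; rewrite eq_sym => /negPf ->.
Qed.

Lemma Kcyc_le (n : nat) (s : 'S_n) : Kcyc s <= n.
Proof. by rewrite -[X in _ <= X]card_ord leq_imset_card. Qed.

Section Weights.
Local Open Scope ring_scope.
Variable K : numFieldType.
Implicit Types (x : nat -> K) (r : nat -> nat) (E : (nat -> nat) -> bool).

(** The range [N] is decoupled from the size of the permutation, because the recurrences compare
    permutations of different sizes under one product. *)
Definition type_weight N x r : K := \prod_(1 <= j < N.+1) x j ^+ r j.

Lemma type_weight_incr N x l r : (0 < l <= N)%N ->
  type_weight N x (incr l r) = x l * type_weight N x r.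
Proof.
move=> lN; rewrite /type_weight.
rewrite (bigD1_seq l) ?iota_uniq ?mem_index_iota //= [in RHS](bigD1_seq l) ?iota_uniq ?mem_index_iota //=.
rewrite {1}/incr eqxx add1n exprS mulrA; congr (_ * _).
by apply: eq_bigr => j jl; rewrite /incr (negPf jl).
Qed.

Lemma type_weight_widen N n x (s : 'S_n) : (n <= N)%N ->
  type_weight N x (cycle_type s) = type_weight n x (cycle_type s).
Proof.
move=> nN; rewrite /type_weight (big_cat_nat (n := n.+1)) //=.
rewrite [X in _ * X]big_nat [X in _ * X]big1 ?mulr1 // => j /andP [nj _].
by rewrite cycle_type_eq0.
Qed.

(** The unnormalised probability of [E], that is, its probability times [h_n]; for [n <= N] it does
    not depend on [N]. *)
Definition restricted_mean N x E n : K :=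
  type_mean n (fun r => if E r then type_weight N x r else 0).

Lemma restricted_mean_incr N x E n l : (0 < l <= N)%N ->
  type_mean n (fun r => if E (incr l r) then type_weight N x (incr l r) else 0)
  = x l * restricted_mean N x (fun r => E (incr l r)) n.
Proof.
move=> lN; rewrite /restricted_mean /type_mean mulrA; congr (_ / _).
rewrite mulr_sumr; apply: eq_bigr => s _; case: ifP => _; last by rewrite mulr0.
exact: type_weight_incr.
Qed.

Lemma restricted_mean_rec N x E n : (n <= N)%N ->
  n%:R * restricted_mean N x E n = \sum_(m < n)
    x (n - m)%N * restricted_mean N x (fun r => E (incr (n - m) r)) m.
Proof.
case: n => [|n] nN; first by rewrite mul0r big_ord0.
rewrite /restricted_mean type_mean_unfold; apply: eq_bigr => m _.
by rewrite restricted_mean_incr // subn_gt0 ltn_ord (leq_trans (leq_subr _ _)).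
Qed.

(** Indexing by the length [l] of the removed cycle, over a range free of [n], allows the sum to be
    cut at a fixed length [b]. *)
Lemma restricted_mean_rec_rev N x E n : (n <= N)%N ->
  n%:R * restricted_mean N x E n = \sum_(1 <= l < N.+1)
    if (l <= n)%N then x l * restricted_mean N x (fun r => E (incr l r)) (n - l) else 0.
Proof.
move=> nN; rewrite restricted_mean_rec // (big_cat_nat (n := n.+1)) //=.
rewrite [X in _ + X]big_nat [X in _ + X]big1 ?addr0; last first.
  by move=> l /andP [nl _]; rewrite leqNgt nl.
rewrite big_add1 /= big_rev_mkord subn0; apply: eq_bigr => m _.
have mn : (m < n)%N := ltn_ord m.
rewrite subnS prednK ?subn_gt0 // leq_subr; congr (_ * restricted_mean _ _ _ _).
by rewrite subKn // ltnW.
Qed.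

Lemma restricted_mean_eq N x x' E E' n :
  (forall r, (if E r then type_weight N x r else 0) = if E' r then type_weight N x' r else 0) ->
  restricted_mean N x E n = restricted_mean N x' E' n.
Proof. by move=> H; rewrite /restricted_mean; congr type_mean; apply/funext. Qed.

Lemma restricted_mean_false N x n : restricted_mean N x (fun=> false) n = 0.
Proof. by rewrite /restricted_mean /type_mean big1 ?mul0r. Qed.

Lemma restricted_mean_widen N x E n : (n <= N)%N ->
  restricted_mean N x E n = restricted_mean n x E n.
Proof.
move=> nN; rewrite /restricted_mean /type_mean; congr (_ / _).
by apply: eq_bigr => s _; rewrite type_weight_widen.
Qed.

Lemma restricted_mean_0 N x E :
  restricted_mean N x E 0 = (E (fun=> 0%N))%:R.
Proof.
rewrite /restricted_mean /type_mean fact0 divr1.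
have T0 (s : 'S_0) : cycle_type s = fun=> 0%N.
  by apply/funext => -[|j]; rewrite ?cycle_type0 ?cycle_type_eq0.
rewrite (eq_bigr (fun=> (E (fun=> 0%N))%:R)).
  by rewrite sumr_const card_Sn.
move=> s _; rewrite T0; case: (E _) => //; rewrite /type_weight big1 //.
Qed.

Lemma restricted_mean_le N x E E' n : (forall j, (0 < j)%N -> 0 <= x j) ->
  (forall r, E r -> E' r) ->
  0 <= restricted_mean N x E n <= restricted_mean N x E' n.
Proof.
move=> x0 EE; have w0 r : 0 <= type_weight N x r.
  rewrite /type_weight big_nat prodr_ge0 // => j /andP [j0 _]; rewrite exprn_ge0 ?x0 //.
apply/andP; split; first by rewrite divr_ge0 // sumr_ge0 // => s _; case: ifP.
rewrite ler_wpM2r // ?invr_ge0 //; apply: ler_sum => s _.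
by case: ifP => [/EE -> //|_]; case: ifP.
Qed.

(** * The masses [h_n] and their decomposition by number of cycles *)

Definition hmean x n : K := restricted_mean n x (fun=> true) n.

Lemma hmean_rec x n : n%:R * hmean x n = \sum_(m < n) x (n - m)%N * hmean x m.
Proof.
rewrite /hmean restricted_mean_rec //; apply: eq_bigr => m _.
by rewrite restricted_mean_widen // ltnW.
Qed.

Definition kmean x k n : K :=
  restricted_mean n x (fun r => \sum_(1 <= j < n.+1) r j == k)%N n.

Lemma kmean_widen N x k n : (n <= N)%N ->
  kmean x k n = restricted_mean N x (fun r => \sum_(1 <= j < N.+1) r j == k)%N n.
Proof.
move=> nN; rewrite /kmean /restricted_mean /type_mean; congr (_ / _).
by apply: eq_bigr => s _; rewrite type_weight_widen // -!Kcyc_cycle_type.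
Qed.

Lemma sum_incr N l r : (0 < l <= N)%N ->
  (\sum_(1 <= j < N.+1) incr l r j = (\sum_(1 <= j < N.+1) r j).+1)%N.
Proof.
move=> lN; rewrite big_split /= (bigD1_seq l) ?iota_uniq ?mem_index_iota //= eqxx.
by rewrite big1 ?addn0 // => j /negPf ->.
Qed.

Lemma kmean_rec x k n :
  n%:R * kmean x k n = if k is k'.+1 then \sum_(m < n) x (n - m)%N * kmean x k' m else 0.
Proof.
rewrite /kmean restricted_mean_rec //.
have H (m : 'I_n) : (0 < n - m <= n)%N by rewrite subn_gt0 ltn_ord leq_subr.
case: k => [|k].
  rewrite big1 // => m _; rewrite [X in _ * X](_ : _ = restricted_mean n x (fun=> false) m).
    by rewrite restricted_mean_false mulr0.
  by apply: restricted_mean_eq => r; rewrite sum_incr.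
apply: eq_bigr => m _; rewrite -/(kmean x k m) (@kmean_widen n) 1?ltnW //; congr (_ * _).
by apply: restricted_mean_eq => r; rewrite sum_incr // eqSS.
Qed.

Lemma kmean_0 x k : kmean x k 0 = (k == 0)%:R.
Proof. by rewrite /kmean restricted_mean_0 big_nil eq_sym. Qed.

Lemma hmean_kmean x n N : (n < N)%N -> hmean x n = \sum_(k < N) kmean x k n.
Proof.
move=> nN; rewrite /hmean /kmean /restricted_mean /type_mean -mulr_suml; congr (_ / _).
rewrite exchange_big; apply: eq_bigr => s _ /=.
rewrite -Kcyc_cycle_type // -big_mkcond /=.
have Kn : (Kcyc s < N)%N by rewrite (leq_ltn_trans (Kcyc_le s)).
by rewrite (big_pred1 (Ordinal Kn)) // => i; rewrite -val_eqE /= eq_sym.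
Qed.

(** * Convolution powers *)

Fixpoint conv_pow (p : nat -> K) k n : K :=
  if k is k'.+1 then \sum_(j < n.+1) p j * conv_pow p k' (n - j)%N else (n == 0)%:R.

(** Truncation at [N > n] does not affect the coefficient, so polynomials can stand in for formal
    power series and their derivatives. *)
Lemma conv_pow_poly p k n N : (n < N)%N ->
  conv_pow p k n = ((\poly_(i < N) p i) ^+ k)`_n.
Proof.
elim: k n => [|k IH] n nN; first by rewrite expr0 coef1.
rewrite exprS coefM /=; apply: eq_bigr => j _; rewrite coef_poly.
have jN : (j < N)%N by apply: leq_ltn_trans nN; rewrite -ltnS.
by rewrite jN IH // (leq_ltn_trans (leq_subr _ _)).
Qed.

(** Compare coefficients in [(P^(k+1))' = (k+1) P' P^k]; the coefficients of [P'] are the [x j]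
    because [j p_j = x_j] for positive [j]. *)
Lemma conv_pow_rec x k n : let p j := x j / j%:R in
  n%:R * conv_pow p k.+1 n = k.+1%:R * \sum_(m < n) x (n - m)%N * conv_pow p k m.
Proof.
case: n => [|n] p; first by rewrite mul0r big_ord0 mulr0.
rewrite (@conv_pow_poly _ _ _ n.+2) // mulr_natl -coef_deriv deriv_exp /= coefMn mulr_natl.
congr (_ *+ _); rewrite coefMr; apply: eq_bigr => m _.
have mn : (m <= n)%N by rewrite -ltnS.
rewrite coef_deriv coef_poly -subSn // ltnS (leq_trans (leq_subr _ _)) //.
rewrite (@conv_pow_poly p k m n.+2); last by rewrite ltnW // ltnS ltnW.
congr (_ * _); rewrite /p -[LHS]mulr_natr mulfVK // pnatr_eq0 -lt0n subn_gt0 ltn_ord //.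
Qed.

(* Both sides satisfy the recurrence obtained by differentiating a power of the
   generating function. *)
Lemma kmean_conv x k n :
  kmean x k n = conv_pow (fun j => x j / j%:R) k n / k`!%:R.
Proof.
elim: k n => [|k IH] [|n].
- by rewrite kmean_0 /= fact0 divr1.
- by apply/eqP; rewrite mul0r -(mulrI_eq0 _ (@lregP _ n.+1%:R _)) ?kmean_rec // pnatr_eq0.
(* At [n = 0] the convolution vanishes, because its only term contains [x 0 / 0 = 0]. *)
- by rewrite kmean_0 /= big_ord_recl big_ord0 invr0 mulr0 mul0r addr0 mul0r.
apply: (@mulfI _ n.+1%:R); first by rewrite pnatr_eq0.
rewrite kmean_rec mulrA conv_pow_rec factS natrM invfM mulrA [_ * _ / k.+1%:R]mulrAC.
rewrite mulfV ?pnatr_eq0 // mul1r mulr_suml; apply: eq_bigr => m _.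
by rewrite IH mulrA.
Qed.

End Weights.

(** * Prescribing the numbers of short cycles *)

Section SmallCycles.
Local Open Scope ring_scope.
Variable K : numFieldType.
Implicit Types (x : nat -> K) (r k : nat -> nat).

Definition small_event b k r : bool := [forall j : 'I_b, r j.+1 == k j.+1].

Definition decr l k : nat -> nat := fun j => (k j - (j == l))%N.

Lemma small_eventP b k r :
  reflect (forall j, (0 < j <= b)%N -> r j = k j) (small_event b k r).
Proof.
apply: (iffP forallP) => [H [|j] //= jb|H j]; first exact/eqP/(H (Ordinal jb)).
by apply/eqP/H; rewrite /= ltn_ord.
Qed.

(** A new cycle of length [l] uses up one unit of the prescription when [l <= b], which is
    impossible if [k l = 0]; a longer one is not seen by the event. *)
Lemma small_event_incr b k l r : (0 < l)%N -> small_event b k (incr l r) =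
  if (l <= b)%N then (0 < k l)%N && small_event b (decr l k) r else small_event b k r.
Proof.
move=> l0; have [lb|lb] := leqP l b.
  apply/small_eventP/andP => [H|[kl /small_eventP H] j jb].
    split; first by rewrite -H ?l0 // /incr eqxx.
    by apply/small_eventP => j jb; rewrite /decr -H // /incr addKn.
  by rewrite /incr H // /decr; case: eqP => [->|_]; rewrite ?subnKC ?add0n ?subn0.
apply/small_eventP/small_eventP => H j jb; rewrite -?H // /incr.
  by case: eqP jb lb => // ->; lia.
by case: eqP jb lb => // ->; lia.
Qed.

Definition small_size b k : nat := \sum_(1 <= j < b.+1) j * k j.

(** The product of the Poisson masses without their exponential factors. *)
Definition small_coef x b k : K :=
  \prod_(1 <= j < b.+1) ((x j / j%:R) ^+ k j / (k j)`!%:R).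

(** Zero weights on lengths up to [b] make [hmean (large_part x b)] the mass of permutations without
    short cycles. *)
Definition large_part x b : nat -> K := fun j => if (j <= b)%N then 0 else x j.

Lemma small_size_ge b k l : (0 < l <= b)%N -> (l * k l <= small_size b k)%N.
Proof.
move=> lb; rewrite /small_size (bigD1_seq l) ?iota_uniq ?mem_index_iota //=.
exact: leq_addr.
Qed.

Lemma small_size_decr b k l : (0 < l <= b)%N -> (0 < k l)%N ->
  small_size b k = (small_size b (decr l k) + l)%N.
Proof.
move=> lb kl; rewrite /small_size (bigD1_seq l) ?iota_uniq ?mem_index_iota //=.
rewrite [in RHS](bigD1_seq l) ?iota_uniq ?mem_index_iota //= addnAC; congr (_ + _)%N.
  by rewrite /decr eqxx mulnBr muln1 subnK // leq_pmulr.
by apply: eq_bigr => j /negPf jl; rewrite /decr jl subn0.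
Qed.

Lemma small_coef_decr x b k l : (0 < l <= b)%N -> (0 < k l)%N ->
  x l * small_coef x b (decr l k) = (l * k l)%:R * small_coef x b k.
Proof.
move=> lb kl; rewrite /small_coef (bigD1_seq l) ?iota_uniq ?mem_index_iota //=.
rewrite [in RHS](bigD1_seq l) ?iota_uniq ?mem_index_iota //= !mulrA; congr (_ * _).
  rewrite /decr eqxx subn1; case: (k l) kl => // q _ /=.
  rewrite factS exprS !natrM; field.
  by rewrite nat1r !pnatr_eq0 -lt0n fact_gt0 /=; case/andP: lb; rewrite lt0n.
by apply: eq_bigr => j /negPf jl; rewrite /decr jl subn0.
Qed.

Lemma hmean_rec_rev x n N : (n <= N)%N ->
  n%:R * hmean x n = \sum_(1 <= l < N.+1) if (l <= n)%N then x l * hmean x (n - l) else 0.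
Proof.
move=> nN; rewrite /hmean -(@restricted_mean_widen _ N) //.
rewrite restricted_mean_rec_rev //; apply: eq_bigr => l _; case: ifP => // ln.
by rewrite restricted_mean_widen // (leq_trans (leq_subr _ _)).
Qed.

(** Strong induction on [n] through the recurrence. With [M] the prescribed number of points in
    short cycles, removing short cycles contributes the factor [M] and removing long ones the factor
    [n - M], together [n]. *)
Lemma small_event_mean N x b k n : (b <= N)%N -> (n <= N)%N ->
  restricted_mean N x (small_event b k) n =
  if (small_size b k <= n)%N
  then small_coef x b k * hmean (large_part x b) (n - small_size b k) else 0.
Proof.
move=> bN; elim/ltn_ind: n k => n IH k nN.
have [->|n0] := posnP n.
  rewrite restricted_mean_0 leqn0 sub0n.
  have -> : small_event b k (fun=> 0%N) = (small_size b k == 0%N).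
    apply/small_eventP/eqP => [H|H j jb].
      rewrite /small_size big_nat big1 // => j /andP [j0]; rewrite ltnS => jb.
      by rewrite -H ?muln0 // j0.
    have := small_size_ge k jb; rewrite H leqn0 muln_eq0.
    by case/andP: jb; case: j => // j _ _ /eqP ->.
  case: eqP => // E; rewrite /hmean restricted_mean_0 mulr1 /small_coef.
  rewrite big_nat big1 // => j /andP [j0]; rewrite ltnS => jb.
  have := @small_size_ge b k j; rewrite E leqn0 muln_eq0 j0 jb => /(_ isT).
  by case: j j0 {jb} => // j _ /= /eqP ->; rewrite expr0 fact0 divr1.
apply: (@mulfI _ n%:R); first by rewrite pnatr_eq0 -lt0n.
rewrite restricted_mean_rec_rev //.
set M := small_size b k; set C := small_coef x b k.
(* The first summand carries the lengths [l <= b], the second the lengths [l > b], where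
   [large_part] is nonzero; each vanishes on the other range. *)
transitivity (\sum_(1 <= l < N.+1)
   ((if (l <= b)%N then (if (M <= n)%N then (l * k l)%:R * C * hmean (large_part x b) (n - M) else 0) else 0)
   + (if (M <= n)%N then C * (if (l <= n - M)%N then large_part x b l * hmean (large_part x b) (n - M - l) else 0) else 0))).
  apply: eq_big_nat => l /andP [l0 lN].
  have [lb|lb] := leqP l b.
    rewrite [X in _ + X](_ : _ = 0) ?addr0; last first.
      by rewrite /large_part lb mul0r; do 2!case: ifP => // _; rewrite mulr0.
    have [kl|kl] := posnP (k l).
      rewrite kl muln0 !mul0r !if_same; case: ifP => // ln.
      rewrite (_ : restricted_mean _ _ _ _ = restricted_mean N x (fun=> false) (n - l)).
        by rewrite restricted_mean_false mulr0.
      by apply: restricted_mean_eq => r; rewrite small_event_incr // lb kl.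
    have lb' : (0 < l <= b)%N by rewrite l0.
    have EM := small_size_decr lb' kl.
    rewrite (_ : restricted_mean _ _ _ _ = restricted_mean N x (small_event b (decr l k)) (n - l)); last first.
      by apply: restricted_mean_eq => r; rewrite small_event_incr // lb kl.
    case: leqP => ln; last first.
      by rewrite /M EM ifN // -ltnNge (leq_trans ln) // leq_addl.
    rewrite IH ?ltn_subrL ?l0 //; last by rewrite (leq_trans (leq_subr _ _)).
    rewrite leq_subRL // addnC -EM; case: ifP => MN; last by rewrite mulr0.
    by rewrite -small_coef_decr // mulrA -subnDA addnC -EM.
  rewrite add0r.
  rewrite (_ : restricted_mean _ _ _ _ = restricted_mean N x (small_event b k) (n - l)); last first.
    by apply: restricted_mean_eq => r; rewrite small_event_incr // leqNgt lb.
  case: leqP => ln; last first.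
    rewrite [X in C * X]ifN ?mulr0 ?if_same // -ltnNge (leq_ltn_trans _ ln) //.
    exact: leq_subr.
  rewrite IH ?ltn_subrL ?l0 //; last by rewrite (leq_trans (leq_subr _ _)).
  rewrite leq_subRL // -/M; have [Mn|Mn] := leqP M n; last first.
    by rewrite ifN ?mulr0 // -ltnNge (leq_trans Mn) // leq_addl.
  rewrite leq_subRL // [(M + l)%N]addnC; case: ifP => _; last by rewrite !mulr0.
  by rewrite /large_part leqNgt lb /= -!subnDA [(l + M)%N]addnC mulrCA.
rewrite big_split /=.
case: leqP => Mn; last by rewrite !big1 ?addr0 ?mulr0 // => l _; rewrite if_same.
rewrite -mulr_sumr -hmean_rec_rev; last by rewrite (leq_trans (leq_subr _ _)).
rewrite (big_cat_nat (n := b.+1)) //= [X in _ + X + _]big_nat [X in _ + X + _]big1 ?addr0; last first.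
  by move=> l /andP [bl _]; rewrite leqNgt bl.
under eq_big_nat => l /andP [_ lb] do rewrite -ltnS lb -mulrA.
by rewrite -mulr_suml -natr_sum -/(small_size b k) -/M natrB //; ring.
Qed.
End SmallCycles.

(** * Probabilities as ratios of weighted sums *)

Section Probabilities.
Local Open Scope ring_scope.
Variable theta : nat -> R.

Lemma Rsum_seqE (T : Type) (s : seq T) (f : T -> R) :
  Rsum_seq s f = \sum_(x <- s) f x.
Proof. by elim: s => [|x s IH]; rewrite ?big_nil // big_cons -IH. Qed.

Lemma Rprod_seqE (T : Type) (s : seq T) (f : T -> R) :
  Rprod_seq s f = \prod_(x <- s) f x.
Proof. by elim: s => [|x s IH]; rewrite ?big_nil // big_cons -IH. Qed.

Lemma weightE n (s : 'S_n) : weight theta s = type_weight n theta (cycle_type s).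
Proof.
rewrite /weight Rprod_seqE /type_weight /index_iota subn1.
by apply: eq_bigr => j _; rewrite RpowE.
Qed.

Lemma hseqE n : hseq theta n = hmean theta n.
Proof.
rewrite /hseq Rsum_seqE RdivE INRE big_enum /hmean /restricted_mean /type_mean.
by congr (_ / _); apply: eq_bigr => s _; rewrite weightE.
Qed.

Lemma PnE n (A : pred 'S_n) :
  Pn theta A = (\sum_(s : 'S_n | A s) weight theta s) / n`!%:R / hmean theta n.
Proof.
rewrite /Pn Rsum_seqE RdivE RmultE INRE hseqE big_filter big_enum_cond /=.
by rewrite invfM mulrA.
Qed.

Lemma Pn_restricted n (E : (nat -> nat) -> bool) (A : pred 'S_n) :
  (forall s, A s = E (cycle_type s)) ->
  Pn theta A = restricted_mean n theta E n / hmean theta n.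
Proof.
move=> AE; rewrite PnE; congr (_ / _ / _); rewrite big_mkcond.
by apply: eq_bigr => s _; rewrite AE; case: ifP => // _; rewrite weightE.
Qed.

Lemma Pn_Kcyc n k :
  Pn theta (fun s : 'S_n => Kcyc s == k) = kmean theta k n / hmean theta n.
Proof.
rewrite /kmean -(@Pn_restricted n _ (fun s : 'S_n => Kcyc s == k)) // => s.
by rewrite (@Kcyc_cycle_type n).
Qed.

Lemma Pn_small_event n b k :
  Pn theta (@Rvec_event n b k) =
  (if (small_size b k <= n)%N then small_coef theta b k *
     hmean (large_part theta b) (n - small_size b k) else 0) / hmean theta n.
Proof.
rewrite (@Pn_restricted n (small_event b k)) //.
rewrite -(@restricted_mean_widen _ (n + b)) ?leq_addr //.
by rewrite small_event_mean ?leq_addr ?leq_addl.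
Qed.

(** Fixing the cycle of the marked point leaves a free permutation of [m] points; the factor [n] is
    the quotient of n! by (n-1)!. The condition [m < n] makes the cycle length positive. *)
Lemma Pn_L1 n m : (m < n)%N ->
  Pn theta (fun s : 'S_n => L1 s == n - m)%N =
  theta (n - m)%N * hmean theta m / (n%:R * hmean theta n).
Proof.
case: n => // n mn.
have lN : (0 < n.+1 - m <= n.+1)%N by rewrite subn_gt0 mn leq_subr.
have E : (\sum_(s : 'S_n.+1 | L1 s == (n.+1 - m)%N) weight theta s) / n`!%:R
    = theta (n.+1 - m)%N * hmean theta m.
  under eq_bigr => s _ do rewrite weightE.
  have -> := type_mean_marked (type_weight n.+1 theta) lN.
  rewrite subKn; last exact: ltnW.
  have := restricted_mean_incr theta (fun=> true) m lN; rewrite /= => ->.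
  by rewrite restricted_mean_widen // ltnW.
rewrite PnE -E factS natrM; move: (hmean theta n.+1) => H.
by rewrite !invfM !mulrA; congr (_ * _); rewrite mulrAC.
Qed.
End Probabilities.

(** * Limits and series *)

Section Limits.
Local Open Scope ring_scope.
Implicit Types (u v a : nat -> R) (l : R).

Lemma lim_seqP u l : is_lim_seq u l <->
  forall e : R, 0 < e -> exists N, forall n, (N <= n)%N -> `|u n - l| < e.
Proof.
split=> [/is_lim_seq_spec H e /RltP e0|H].
  have [N HN] := H (mkposreal e e0); exists N => n /ssrnat.leP /HN /RltP.
  by rewrite RabsE.
apply/is_lim_seq_spec => -[e e0]; have [N HN] := H e (introT RltP e0).
exists N => n /ssrnat.leP /HN.
by rewrite -RabsE => /RltP.
Qed.

Lemma lim_ext (N : nat) u v l : (forall n, (N <= n)%N -> u n = v n) ->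
  is_lim_seq u l -> is_lim_seq v l.
Proof. by move=> E; apply: is_lim_seq_ext_loc; exists N => n /ssrnat.leP /E. Qed.

Lemma lim_shift (k : nat) u l :
  is_lim_seq u l <-> is_lim_seq (fun n => u (n + k)%N) l.
Proof. exact: is_lim_seq_incr_n. Qed.

Lemma lim_le_const (N : nat) u l b : is_lim_seq u l ->
  (forall n, (N <= n)%N -> u n <= b) -> l <= b.
Proof.
move=> ul H; apply/RleP.
have := @is_lim_seq_le_loc u (fun=> b) l b; apply => //; last exact: is_lim_seq_const.
by exists N => n /ssrnat.leP /H /RleP.
Qed.

Lemma lim_squeeze0 (N : nat) u v : (forall n, (N <= n)%N -> 0 <= u n <= v n) ->
  is_lim_seq v (0 : R) -> is_lim_seq u (0 : R).
Proof.
move=> H; apply: (@is_lim_seq_le_le_loc (fun=> 0)); last exact: is_lim_seq_const.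
by exists N => n /ssrnat.leP /H /andP [/RleP ? /RleP ?].
Qed.

Lemma lim_inv_nat : is_lim_seq (fun n => n%:R^-1 : R) (0 : R).
Proof.
apply/lim_seqP => e e0; exists (Num.bound e^-1) => n nN.
have eN : e^-1 < n%:R.
  apply: lt_le_trans (archi_boundP _) _; first by rewrite invr_ge0 ltW.
  by rewrite ler_nat.
have n0 : 0 < n%:R :> R by apply: lt_trans eN; rewrite invr_gt0.
by rewrite subr0 ger0_norm ?invr_ge0 ?ltW // invf_plt.
Qed.

(** Partial sums run over [i < n], one term fewer than in [sum_n a n], to match sums over
    ordinals. *)
Definition sums_to a l := is_lim_seq (fun n => \sum_(i < n) a i) l.

#[global] Arguments sums_to _ _ : clear scopes.

Lemma sums_to_series a l : sums_to a l <-> is_series a l.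
Proof.
rewrite /sums_to is_lim_seq_incr_1.
suff E n : \sum_(i < n.+1) a i = sum_n a n.
  by rewrite -[is_series a l]/(is_lim_seq (sum_n a) l); split; apply: is_lim_seq_ext => n; rewrite E.
by rewrite sum_n_Reals sum_f_R0E big_mkord.
Qed.

Lemma sums_to_infinite_sum a l : sums_to a l <-> infinite_sum a l.
Proof. by rewrite sums_to_series is_series_Reals. Qed.

Lemma sums_to_ext a b l : (forall n, a n = b n) -> sums_to a l -> sums_to b l.
Proof. by move=> E; apply: is_lim_seq_ext => n; apply: eq_bigr => i _; rewrite E. Qed.

Lemma partial_sum_le a l n : (forall i, 0 <= a i) -> sums_to a l ->
  \sum_(i < n) a i <= l.
Proof.
move=> a0 al; rewrite -subr_ge0 -oppr_le0 opprB.
have al' : is_lim_seq (fun m => (\sum_(i < n) a i) - \sum_(i < m) a i) (\sum_(i < n) a i - l).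
  exact: (is_lim_seq_minus' _ _ _ _ (is_lim_seq_const _) al).
apply: (lim_le_const (N := n) al') => m nm.
rewrite subr_le0 -!(big_mkord predT a) (big_cat_nat (n := n) (p := m)) //= lerDl.
by apply: sumr_ge0.
Qed.

(** Dominated convergence for series in which the number of terms grows with [n] as well. *)
Lemma tannery (F : nat -> nat -> R) (f M : nat -> R) (lf lM : R) :
  (forall n m, `|F n m| <= M m) -> sums_to M lM ->
  (forall m, is_lim_seq (fun n => F n m) (f m)) -> sums_to f lf ->
  is_lim_seq (fun n => \sum_(m < n) F n m) lf.
Proof.
move=> FM Ml Ff fl; apply/lim_seqP => e e0.
(* The four quarters: two bound the block of [M] from [N] to [n], one the tail of [f], one the
   convergence of the first [N] terms. *)
have e4 : 0 < e / 4%:R by rewrite divr_gt0 // ltr0n.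
have M0 m : 0 <= M m by apply: le_trans (FM 0%N m).
have [N1 H1] := (lim_seqP _ _).1 Ml _ e4.
have [N2 H2] := (lim_seqP _ _).1 fl _ e4.
pose N := maxn N1 N2.
have HN : is_lim_seq (fun n => \sum_(m < N) F n m) (\sum_(m < N) f m).
  elim: N => [|N IH].
    rewrite big_ord0; apply: is_lim_seq_ext (is_lim_seq_const (0 : R)) => n.
    by rewrite big_ord0.
  rewrite big_ord_recr /=.
  have := is_lim_seq_plus' _ _ _ _ IH (Ff N); apply: is_lim_seq_ext => n.
  by rewrite big_ord_recr.
have [N3 H3] := (lim_seqP _ _).1 HN _ e4.
exists (maxn N N3) => n; rewrite geq_max => /andP [nN nN3].
have := H3 n nN3; have := H2 N (leq_maxr _ _); have := H1 N (leq_maxl _ _).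
have := H1 n (leq_trans (leq_maxl _ _) nN).
rewrite -!(big_mkord predT (F n)) (big_cat_nat (n := N) (p := n)) //=.
rewrite -!(big_mkord predT M) (big_cat_nat (n := N) (p := n) _ _ (F := M)) //=.
have tail : `|\sum_(N <= m < n) F n m| <= \sum_(N <= m < n) M m.
  by apply: le_trans (ler_norm_sum _ _ _) _; apply: ler_sum.
move: tail; rewrite !ltr_norml ler_norml.
set A := \sum_(0 <= m < N) M m; set B := \sum_(N <= m < n) M m.
set G := \sum_(0 <= m < N) F n m; set G' := \sum_(N <= m < n) F n m.
set f' := \sum_(i < N) f i.
move=> /andP [? ?] /andP [? ?] /andP [? ?] /andP [? ?] /andP [? ?].
apply/andP; split; lra.
Qed.

Lemma sums_to_shift a l : sums_to a l -> a 0%N = 0 -> sums_to (fun i => a i.+1) l.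
Proof.
move=> al a0; move: (al); rewrite /sums_to is_lim_seq_incr_1; apply: is_lim_seq_ext => n.
by rewrite big_ord_recl a0 add0r.
Qed.

Lemma sums_to_unshift a l : sums_to (fun i => a i.+1) l -> a 0%N = 0 -> sums_to a l.
Proof.
move=> al a0; rewrite /sums_to is_lim_seq_incr_1; apply: is_lim_seq_ext al => n.
by rewrite big_ord_recl a0 add0r.
Qed.

Lemma sums_toZ (z : R) a l : sums_to a l -> sums_to (fun i => z * a i) (z * l).
Proof.
move=> al; have := is_lim_seq_mult' _ _ _ _ (is_lim_seq_const z) al.
by apply: is_lim_seq_ext => n; rewrite RmultE mulr_sumr.
Qed.

Lemma sums_to_dominated a b l : (forall n, 0 <= a n <= b n) -> sums_to b l ->
  exists l', sums_to a l'.
Proof.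
move=> ab /sums_to_series bl.
have [l' H] : ex_series a.
  apply: (@ex_series_le _ _ a b); last by exists l.
  move=> n; apply/RleP; rewrite /norm /= /abs /= RabsE ger0_norm; by case/andP: (ab n).
by exists l'; apply/sums_to_series.
Qed.

Lemma exp_sums (z : R) : sums_to (fun k => z ^+ k / k`!%:R) (exp z).
Proof.
apply/sums_to_series/is_series_Reals; move: (is_exp_Reals z) => /is_pseries_R /is_series_Reals.
congr (infinite_sum _ _); apply/funext => k.
by rewrite factE INRE RpowE RinvE RmultE mulrC.
Qed.

End Limits.

(** * Total masses and subexponential bounds *)

Section TotalMass.
Local Open Scope ring_scope.
Implicit Types (x p : nat -> R).

Lemma conv_pow_ge0 p k n : (forall j, 0 <= p j) -> 0 <= conv_pow p k n.
Proof.
move=> p0; elim: k n => [|k IH] n /=; first exact: ler0n.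
by apply: sumr_ge0 => j _; rewrite mulr_ge0.
Qed.

Lemma sums_to_ex_abs p l : (forall j, 0 <= p j) -> sums_to p l ->
  ex_series (fun n => Rabs (p n)).
Proof.
move=> p0 /sums_to_series pl; exists l; apply: is_series_ext pl => n.
by rewrite RabsE ger0_norm.
Qed.

(** Cauchy products of nonnegative, hence absolutely convergent, series. *)
Lemma conv_pow_sums p k (lam : R) : (forall j, 0 <= p j) -> sums_to p lam ->
  sums_to (conv_pow p k) (lam ^+ k).
Proof.
move=> p0 pl; elim: k => [|k IH].
  apply/(lim_shift 1)/(is_lim_seq_ext (fun=> (1 : R))); last exact: is_lim_seq_const.
  by move=> n; rewrite addn1 big_ord_recl big1 ?addr0 //.
apply/sums_to_series; rewrite exprS.
have := is_series_mult _ _ _ _ ((sums_to_series _ _).1 pl) ((sums_to_series _ _).1 IH)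
  (sums_to_ex_abs p0 pl) (sums_to_ex_abs (fun j => conv_pow_ge0 k j p0) IH).
by apply: is_series_ext => n; rewrite sum_f_R0E big_mkord /=.
Qed.

Lemma kmean_ge0 x k n : (forall j, (0 < j)%N -> 0 <= x j) -> 0 <= kmean x k n.
Proof.
by move=> x0; case/andP: (@restricted_mean_le _ n x (fun r => \sum_(1 <= j < n.+1) r j == k)%N (fun=> true) n x0 (fun _ _ => isT)).
Qed.

Lemma hmean_ge0 x n : (forall j, (0 < j)%N -> 0 <= x j) -> 0 <= hmean x n.
Proof. by move=> x0; case/andP: (@restricted_mean_le _ n x (fun=> true) (fun=> true) n x0 (fun _ _ => isT)). Qed.

Lemma kmean_le_hmean x k n : (forall j, (0 < j)%N -> 0 <= x j) -> kmean x k n <= hmean x n.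
Proof.
by move=> x0; case/andP: (@restricted_mean_le _ n x (fun r => \sum_(1 <= j < n.+1) r j == k)%N (fun=> true) n x0 (fun _ _ => isT)).
Qed.

Lemma hmean_0 x : hmean x 0 = 1.
Proof. by rewrite /hmean restricted_mean_0. Qed.

(** The term [m = 0] of the recurrence, a single cycle through all points, is already positive. *)
Lemma hmean_gt0 x n : (forall j, (0 < j)%N -> 0 < x j) -> 0 < hmean x n.
Proof.
move=> x0; have x0' j : (0 < j)%N -> 0 <= x j by move=> /x0 /ltW.
case: n => [|n]; first by rewrite hmean_0.
rewrite -(pmulr_rgt0 _ (ltr0Sn R n)) hmean_rec big_ord_recl /= hmean_0 mulr1.
rewrite ltr_pwDl ?x0 ?subn0 // sumr_ge0 // => m _.
rewrite mulr_ge0 ?hmean_ge0 ?x0' // subn_gt0; exact: (ltn_ord (lift ord0 m)).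
Qed.

Variable x : nat -> R.
Hypothesis x0 : forall j, (0 < j)%N -> 0 <= x j.
(* [p 0 = 0], since [0^-1 = 0]. *)
Let p j := x j / j%:R.

Lemma weight_div_ge0 j : 0 <= p j.
Proof. by case: j => [|j]; rewrite /p ?invr0 ?mulr0 // divr_ge0 ?x0. Qed.

Lemma kmean_sums k (lam : R) : sums_to p lam -> sums_to (kmean x k) (lam ^+ k / k`!%:R).
Proof.
move=> pl; have := @sums_toZ (k`!%:R^-1) _ _ (@conv_pow_sums _ k _ weight_div_ge0 pl).
by rewrite mulrC; apply: sums_to_ext => n; rewrite kmean_conv mulrC.
Qed.

(** For [n < N] there are fewer than [N] cycles, so the partial sum is a finite double sum over [n]
    and [k]. After exchange, the inner sums are dominated by their own limits, which add up to the
    exponential series. *)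
Lemma hmean_sums (lam : R) : sums_to p lam -> sums_to (hmean x) (exp lam).
Proof.
move=> pl.
have := @tannery (fun N k => \sum_(n < N) kmean x k n) (fun k => lam ^+ k / k`!%:R)
   (fun k => lam ^+ k / k`!%:R) (exp lam) (exp lam) _ (@exp_sums lam) (fun k => @kmean_sums k _ pl) (@exp_sums lam).
move=> H; apply: is_lim_seq_ext (H _) => [N|N k].
  rewrite exchange_big; apply: eq_bigr => n _.
  by rewrite (@hmean_kmean _ x n N).
rewrite ger0_norm; last by rewrite sumr_ge0 // => n _; apply: kmean_ge0.
by apply: partial_sum_le (@kmean_sums k _ pl) => n; apply: kmean_ge0.
Qed.

(* A Kesten-type bound for the subexponential sequence [p]. *)
Lemma conv_pow_le (D : R) k n : 0 <= D ->
  (forall m, (0 < m)%N -> \sum_(j < m) p j * p (m - j)%N <= D * p m) ->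
  (0 < n)%N -> conv_pow p k.+1 n <= D ^+ k * p n.
Proof.
move=> D0 HD; elim: k n => [|k IH] n n0.
  rewrite /= expr0 mul1r (bigD1 ord_max) //= subnn mulr1 big1 ?addr0 // => j jn.
  have -> : (n - j == 0)%N = false; last by rewrite mulr0.
  apply/negbTE; rewrite -lt0n subn_gt0 ltn_neqAle -ltnS ltn_ord andbT.
  by move: jn; rewrite -val_eqE.
(* The term [j = n] drops out because [p 0 = 0] forces the lower convolution power to vanish at
   0. *)
have -> : conv_pow p k.+2 n = \sum_(j < n) p j * conv_pow p k.+1 (n - j)%N.
  rewrite -[LHS]/(\sum_(j < n.+1) p j * conv_pow p k.+1 (n - j)%N) big_ord_recr /=.
  by rewrite subnn big_ord_recl big_ord0 /p invr0 !mulr0 mul0r !addr0 mulr0 addr0.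
rewrite exprS mulrAC; apply: le_trans (ler_wpM2r _ (HD n n0)); last exact: exprn_ge0.
rewrite mulr_suml; apply: ler_sum => j _; rewrite -[leRHS]mulrA ler_wpM2l ?weight_div_ge0 // [leRHS]mulrC.
by rewrite IH // subn_gt0.
Qed.

(** Sum the bounds on convolution powers against [1 / k!]. The term [k = 0] vanishes for positive
    [n], and replacing (k+1)! by k! leaves the series of [exp D]. *)
Lemma hmean_le (D : R) n : 0 <= D ->
  (forall m, (0 < m)%N -> \sum_(j < m) p j * p (m - j)%N <= D * p m) ->
  (0 < n)%N -> hmean x n <= exp D * p n.
Proof.
move=> D0 HD n0; rewrite (@hmean_kmean _ x n n.+1) // big_ord_recl kmean_conv /=.
rewrite [(n == 0)%N](_ : _ = false) ?mul0r ?add0r; last by case: n n0.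
apply: (@le_trans _ _ (\sum_(k < n) D ^+ k / k`!%:R * p n)).
  apply: ler_sum => k _; rewrite kmean_conv -/p mulrAC.
  apply: (@le_trans _ _ (D ^+ k * p n / (k.+1)`!%:R)).
    by rewrite ler_wpM2r ?invr_ge0 ?ler0n ?conv_pow_le.
  apply: ler_wpM2l; first by rewrite mulr_ge0 ?exprn_ge0 ?weight_div_ge0.
  rewrite lef_pV2 ?posrE ?ltr0n ?fact_gt0 //.
  by rewrite ler_nat factS leq_pmull.
rewrite -mulr_suml ler_wpM2r ?weight_div_ge0 //.
by apply: partial_sum_le (@exp_sums D) => k; rewrite divr_ge0 ?exprn_ge0.
Qed.
End TotalMass.

(** * Elementary series and the mass without short cycles *)

Section SeriesAlgebra.
Local Open Scope ring_scope.
Lemma sums_to_delta : sums_to (fun n => (n == 0%N)%:R) 1.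
Proof.
apply/(lim_shift 1)/(is_lim_seq_ext (fun=> (1 : R))); last exact: is_lim_seq_const.
by move=> n; rewrite addn1 big_ord_recl big1 ?addr0.
Qed.

Lemma sums_toD (a b : nat -> R) (l m : R) : sums_to a l -> sums_to b m ->
  sums_to (fun i => a i + b i) (l + m).
Proof.
move=> al bm; have := is_lim_seq_plus' _ _ _ _ al bm.
by apply: is_lim_seq_ext => n; rewrite big_split.
Qed.

Lemma sums_to0 : sums_to (fun=> 0) 0.
Proof. by apply: is_lim_seq_ext (is_lim_seq_const (0 : R)) => n; rewrite big1. Qed.

(** Prescribing no short cycles at all has size 0 and coefficient 1, so the left side is the mass of
    an event. *)
Lemma hmean_large_part_le (x : nat -> R) b n : (forall j, (0 < j)%N -> 0 <= x j) ->
  hmean (large_part x b) n <= hmean x n.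
Proof.
move=> x0; have := small_event_mean x (fun=> 0%N) (leq_addl n b) (leq_addr b n).
have -> : small_size b (fun=> 0%N) = 0%N by rewrite /small_size big1 // => j _; rewrite muln0.
have -> : small_coef x b (fun=> 0%N) = 1.
  by rewrite /small_coef big1 // => j _; rewrite expr0 fact0 divr1.
rewrite leq0n mul1r subn0 => <-; rewrite /hmean -(@restricted_mean_widen _ (n + b)) ?leq_addr //.
by case/andP: (@restricted_mean_le _ (n + b) x (small_event b (fun=> 0%N)) (fun=> true) n x0 (fun _ _ => isT)).
Qed.
End SeriesAlgebra.

(** * Asymptotics of the renewal sums *)

Section Asymptotics.
Local Open Scope ring_scope.
Variables (theta c : nat -> R) (C : R).
Hypothesis theta_gt0 : forall j, (0 < j)%N -> 0 < theta j.
Hypothesis c_sums : sums_to (fun j => c j / j%:R) C.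
Hypothesis theta_bound : forall n j, (0 < j)%N -> (j.*2 <= n)%N ->
  theta (n - j)%N * theta j <= c j * theta n.
Hypothesis ratio : is_lim_seq (fun n => theta n.+1 / theta n) (1 : R).

Let theta_ge0 j : (0 < j)%N -> 0 <= theta j.
Proof. by move/theta_gt0/ltW. Qed.

(** Take [n = 2j] in the bound. *)
Lemma c_ge0 j : (0 < j)%N -> 0 <= c j.
Proof.
move=> j0; have := theta_bound j0 (leqnn _).
rewrite -addnn addnK => H; have t0 := theta_gt0 j0.
have t2 : 0 < theta (j + j)%N by apply: theta_gt0; rewrite addn_gt0 j0.
by rewrite -(pmulr_lge0 _ t2) (le_trans _ H) // mulr_ge0 ?ltW.
Qed.

Lemma cdiv_ge0 j : 0 <= c j / j%:R.
Proof. by case: j => [|j]; rewrite ?invr0 ?mulr0 // divr_ge0 ?c_ge0. Qed.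

(** The quotient telescopes into [m] consecutive ratios, each tending to 1. *)
Lemma ratio_shift m : is_lim_seq (fun n => theta (n - m)%N / theta n) (1 : R).
Proof.
apply/(lim_shift m); elim: m => [|m IH].
  apply: (@lim_ext 1 (fun=> 1)); last exact: is_lim_seq_const.
  by move=> n n1; rewrite addn0 subn0 divff // gt_eqF // theta_gt0.
have r := (lim_shift m _ _).1 ratio.
have one0 : (1 : R) <> 0 by apply/eqP; rewrite oner_eq0.
have := is_lim_seq_div' _ _ _ _ IH r one0.
have -> : Rdiv 1 1 = 1 :> R by rewrite RdivE divr1.
apply: (@lim_ext 1) => n n1; rewrite !addnK RdivE addnS.
have t1 : theta (n + m)%N != 0 by rewrite gt_eqF // theta_gt0 // ltn_addr.
have t2 : theta (n + m).+1 != 0 by rewrite gt_eqF // theta_gt0.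
field; exact/andP.
Qed.

(** Let [n] tend to infinity in the bound with [j] fixed. Summability of [theta j / j] then follows
    from that of [c j / j]. *)
Lemma theta_le_c j : (0 < j)%N -> theta j <= c j.
Proof.
move=> j0; have := is_lim_seq_mult' _ _ _ _ (ratio_shift j) (is_lim_seq_const (theta j)).
rewrite RmultE mul1r => H; apply: (lim_le_const (N := j.*2) H) => n jn.
rewrite RmultE mulrAC ler_pdivrMr ?theta_bound //.
by apply: theta_gt0; rewrite (leq_trans _ jn) // double_gt0.
Qed.

Lemma theta_div_sums : exists lam : R, sums_to (fun j => theta j / j%:R) lam.
Proof.
apply: (sums_to_dominated _ c_sums) => -[|j]; first by rewrite !invr0 !mulr0 lexx.
by rewrite divr_ge0 ?theta_ge0 //= ler_wpM2r ?invr_ge0 // theta_le_c.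
Qed.

Lemma C_ge0 : 0 <= C.
Proof. by have := partial_sum_le 0 cdiv_ge0 c_sums; rewrite big_ord0. Qed.

(* By symmetry one factor has index at least [m / 2], and then
   [1 / (m - j) <= 2 / m]. *)
Lemma theta_conv_le m : (0 < m)%N ->
  \sum_(j < m) (theta j / j%:R) * (theta (m - j)%N / (m - j)%:R) <= 4%:R * C * (theta m / m%:R).
Proof.
move=> m0; have tm := theta_gt0 m0.
have half j : (0 < j)%N -> (j.*2 <= m)%N ->
   (theta j / j%:R) * (theta (m - j)%N / (m - j)%:R) <= 2%:R * (c j / j%:R) * (theta m / m%:R).
  move=> j0 jm.
  have mj : (0 < m - j)%N by lia.
  have j0' : 0 < j%:R :> R by rewrite ltr0n.
  have m0' : 0 < m%:R :> R by rewrite ltr0n.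
  have mj' : 0 < (m - j)%:R :> R by rewrite ltr0n.
  rewrite (_ : _ * _ = (theta (m - j)%N * theta j) * (j%:R * (m - j)%:R)^-1); last first.
    by field; rewrite !gt_eqF.
  rewrite (_ : 2%:R * _ * _ = (c j * theta m) * (2%:R / (j%:R * m%:R))); last first.
    by field; rewrite !gt_eqF.
  apply: ler_pM; rewrite ?mulr_ge0 ?theta_ge0 ?invr_ge0 ?ler0n ?theta_bound //.
    by rewrite ltW ?mulr_gt0.
  rewrite -[leLHS]mul1r ler_pdivrMr ?mulr_gt0 // mulrAC ler_pdivlMr ?mulr_gt0 // mul1r mulrCA.
  rewrite ler_pM2l // -natrM ler_nat; lia.
(* Each term is charged to both [j] and [m - j], which avoids splitting the sum. The two resulting
   sums are at most [C] each, whence [4 = 2 + 2]. *)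
apply: (@le_trans _ _ (\sum_(j < m) (2%:R * (c j / j%:R) + 2%:R * (c (m - j)%N / (m - j)%:R)) * (theta m / m%:R))).
  apply: ler_sum => -[j jm] _ /=.
  have tm0 : 0 <= theta m / m%:R by rewrite divr_ge0 // ltW.
  have [->|j0] := posnP j.
    rewrite {1}invr0 mulr0 mul0r mulr_ge0 // addr_ge0 // mulr_ge0 ?cdiv_ge0 //.
  rewrite mulrDl; have [h|h] := leqP j.*2 m.
    by apply: le_trans (half _ j0 h) _; rewrite lerDl mulr_ge0 // mulr_ge0 ?cdiv_ge0.
  have mj : (0 < m - j)%N by lia.
  have mj2 : ((m - j).*2 <= m)%N by lia.
  have := half _ mj mj2; rewrite subKn ?(ltnW jm) // mulrC => H.
  by apply: le_trans H _; rewrite lerDr mulr_ge0 // mulr_ge0 ?cdiv_ge0.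
rewrite -mulr_suml ler_wpM2r ?divr_ge0 ?(ltW tm) // big_split /= -!mulr_sumr.
have s1 := partial_sum_le m cdiv_ge0 c_sums.
have s2 : \sum_(j < m) c (m - j)%N / (m - j)%:R <= C.
  rewrite (reindex_inj rev_ord_inj) /=.
  apply: le_trans (partial_sum_le m.+1 cdiv_ge0 c_sums).
  rewrite big_ord_recl invr0 mulr0 add0r; apply: ler_sum => j _.
  by rewrite subKn.
lra.
Qed.

Lemma hmean_bound : exists A : R, 0 <= A /\
  forall n, (0 < n)%N -> hmean theta n <= A * (theta n / n%:R).
Proof.
exists (exp (4%:R * C)); split; first exact/RleP/Rlt_le/exp_pos.
move=> n n0; apply: (hmean_le theta_ge0 _ theta_conv_le n0).
by rewrite mulr_ge0 ?C_ge0.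
Qed.

Lemma large_part_bounds b j : (0 < j)%N -> 0 <= large_part theta b j <= theta j.
Proof.
move=> j0; rewrite /large_part; case: ifP => _; last by rewrite theta_ge0 //=.
by rewrite lexx theta_ge0.
Qed.

(** The cutoff [b] covers permutations without short cycles, and [b = 0] gives [theta] itself. The
    cutoff does not alter the limit: for fixed [m], eventually [n - m > b]. *)
Lemma renewal_limit b (f : nat -> R) (l : R) :
  (forall m, 0 <= f m <= hmean theta m) -> sums_to f l ->
  is_lim_seq (fun n => \sum_(m < n) large_part theta b (n - m)%N * f m / theta n) l.
Proof.
move=> fh fl; have [A [A0 hA]] := hmean_bound.
have fA m : (0 < m)%N -> f m <= A * (theta m / m%:R).
  by move=> m0; apply: le_trans (hA m m0); case/andP: (fh m).
have f0 m : 0 <= f m by case/andP: (fh m).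
pose T n m := large_part theta b (n - m)%N * f m / theta n.
(* Both halves of the sum are dominated by [A c_j / j], with [j = m] in the
   first half and [j = n - m] in the second; the second tends to 0 termwise. *)
pose F n m := if (m < n)%N && (m.*2 <= n)%N then T n m else 0.
pose G n j := if (0 < j)%N && (j.*2 < n)%N then T n (n - j)%N else 0.
have T0 n m : (m < n)%N -> 0 <= T n m.
  move=> mn; have nm : (0 < n - m)%N by rewrite subn_gt0.
  rewrite /T divr_ge0 ?mulr_ge0 ?theta_ge0 //; last by lia.
  by case/andP: (large_part_bounds b nm).
have Tle n m : (0 < m < n)%N -> T n m <= A / m%:R * (theta (n - m)%N * theta m / theta n).
  move=> /andP [m0 mn].
  rewrite [leRHS](_ : _ = theta (n - m)%N * (A * (theta m / m%:R)) / theta n); last first.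
    by field; rewrite pnatr_eq0 -lt0n m0 gt_eqF // theta_gt0 //; lia.
  rewrite ler_wpM2r ?invr_ge0 ?theta_ge0 //; first by lia.
  have nm : (0 < n - m)%N by rewrite subn_gt0.
  by case/andP: (large_part_bounds b nm) => ? ?; apply: ler_pM; rewrite ?fA.
have Fl : is_lim_seq (fun n => \sum_(m < n) F n m) l.
  (* The indicator handles [m = 0], where [c m / m] is 0 by convention and [f 0 <= h_0 = 1]. *)
  apply: (@tannery F f (fun m => (m == 0%N)%:R + A * (c m / m%:R)) l (1 + A * C)) => //.
  - move=> n m; have Ac : 0 <= A * (c m / m%:R) by rewrite mulr_ge0 ?cdiv_ge0.
    rewrite /F; case: andP => [[mn m2]|_]; last by rewrite normr0 addr_ge0.
    rewrite ger0_norm ?T0 //; have [E|m0] := posnP m.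
      rewrite E /= invr0 !mulr0 addr0 /T subn0 ler_pdivrMr ?mul1r ?theta_gt0 //; last by lia.
      have n0 : (0 < n)%N by lia.
      case/andP: (large_part_bounds b n0) => ? ?; rewrite -[leRHS]mulr1.
      apply: ler_pM => //; case/andP: (fh 0%N) => _; by rewrite hmean_0.
    rewrite /= add0r (le_trans (Tle _ _ _)) ?m0 // -mulrA ler_wpM2l // mulrC.
    by rewrite ler_wpM2r ?invr_ge0 // ler_pdivrMr ?theta_bound // theta_gt0 //; lia.
  - by apply: sums_toD; [exact: sums_to_delta | exact: sums_toZ].
  - move=> m; have := is_lim_seq_mult' _ _ _ _ (ratio_shift m) (is_lim_seq_const (f m)).
    rewrite RmultE mul1r; apply: (@lim_ext (m.*2 + b).+1) => n nm.
    rewrite RmultE /F /T /large_part.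
    have -> : (m < n)%N && (m.*2 <= n)%N by apply/andP; lia.
    have -> : (n - m <= b)%N = false by lia.
    by rewrite mulrAC.
have Gl : is_lim_seq (fun n => \sum_(j < n) G n j) (0 : R).
  have G0 n j : 0 <= G n j.
    by rewrite /G; case: andP => // -[j0 jn]; apply: T0; lia.
  (* Here [f (n - j)] is at most [A theta (n - j) / (n - j)]. The resulting bound tends to 0 for
     fixed [j], and is at most [A c_j / j] because [n - j >= j]. *)
  have Gle n j : (0 < j)%N -> (j.*2 < n)%N -> G n j <= A * c j * (n - j)%:R^-1.
    move=> j0 jn; rewrite /G j0 jn /=.
    have nj : (0 < n - j < n)%N by lia.
    apply: le_trans (Tle _ _ nj) _; rewrite subKn; last by lia.
    rewrite mulrAC ler_wpM2r ?invr_ge0 // ler_wpM2l // ler_pdivrMr; last by apply: theta_gt0; lia.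
    by rewrite [leLHS]mulrC theta_bound //; lia.
  apply: (@tannery G (fun=> 0) (fun j => A * (c j / j%:R)) 0 (A * C)).
  - move=> n j; rewrite ger0_norm //; case: (boolP ((0 < j)%N && (j.*2 < n)%N)) => [/andP [j0 jn]|h].
      apply: le_trans (Gle _ _ j0 jn) _; rewrite -mulrA ler_wpM2l // ler_wpM2l ?c_ge0 //.
      by rewrite lef_pV2 ?posrE ?ltr0n ?ler_nat; lia.
    by rewrite /G (negPf h) mulr_ge0 ?cdiv_ge0.
  - exact: sums_toZ.
  - move=> j; have [->|j0] := posnP j.
      by apply: is_lim_seq_ext (is_lim_seq_const (0 : R)) => n; rewrite /G.
    apply: (@lim_squeeze0 j.*2.+1 _ (fun n => A * c j * (n - j)%:R^-1)).
      by move=> n jn; rewrite G0 Gle.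
    apply/(lim_shift j); have := is_lim_seq_mult' _ _ _ _ (is_lim_seq_const (A * c j)) lim_inv_nat.
    rewrite (_ : Rmult _ 0 = 0); last by rewrite RmultE mulr0.
    by apply: is_lim_seq_ext => n; rewrite addnK.
  - exact: sums_to0.
have := is_lim_seq_plus' _ _ _ _ Fl Gl; rewrite RplusE addr0.
apply: is_lim_seq_ext => n; rewrite RplusE.
(* [H] is [G] read through [m = n - j]. Adding the zero terms at index [n] makes this reversal a
   bijection of the range. *)
pose H m := if (m < n)%N && (n < m.*2)%N then T n m else 0.
have -> : \sum_(j < n) G n j = \sum_(m < n) H m.
  have Gn : G n n = 0 by rewrite /G; case: ifP => //; lia.
  have Hn : H n = 0 by rewrite /H ltnn.
  have <- : \sum_(j < n.+1) G n j = \sum_(j < n) G n j by rewrite big_ord_recr /= Gn addr0.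
  have <- : \sum_(m < n.+1) H m = \sum_(m < n) H m by rewrite big_ord_recr /= Hn addr0.
  rewrite [LHS](reindex_inj rev_ord_inj) /=; apply: eq_bigr => -[m mn] _ /=.
  rewrite /G /H subSS subKn //; congr (if _ then _ else _); lia.
rewrite -big_split /=; apply: eq_bigr => -[m mn] _ /=.
by rewrite /F /H mn /=; case: leqP => _; rewrite ?addr0 ?add0r.
Qed.

Lemma renewal_limit0 (f g : nat -> R) (l : R) :
  (forall m, 0 <= f m <= hmean theta m) -> sums_to f l ->
  (forall n, n%:R * g n = \sum_(m < n) theta (n - m)%N * f m) ->
  is_lim_seq (fun n => n%:R * g n / theta n) l.
Proof.
move=> fh fl grec; apply: is_lim_seq_ext (renewal_limit 0 fh fl) => n.
rewrite grec mulr_suml; apply: eq_bigr => m _.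
by rewrite /large_part leqNgt subn_gt0 ltn_ord.
Qed.

Lemma hmean_asymp (lam : R) : sums_to (fun j => theta j / j%:R) lam ->
  is_lim_seq (fun n => n%:R * hmean theta n / theta n) (exp lam).
Proof.
move=> /(hmean_sums theta_ge0) hl; apply: renewal_limit0 hl _ => [m|n].
  by rewrite hmean_ge0 //=.
exact: hmean_rec.
Qed.

(** Removing the cycle of 1 leaves [k] cycles, so [k.+1] cycles yield the [k]-th exponential term;
    this is the origin of [K - 1] in the limit law. *)
Lemma kmean_asymp k (lam : R) : sums_to (fun j => theta j / j%:R) lam ->
  is_lim_seq (fun n => n%:R * kmean theta k.+1 n / theta n) (lam ^+ k / k`!%:R)%R.
Proof.
move=> /(kmean_sums theta_ge0 (k := k)) hl; apply: renewal_limit0 hl _ => [m|n].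
  by rewrite kmean_ge0 //= kmean_le_hmean.
exact: kmean_rec.
Qed.

Lemma hmean_large_part_asymp b (lam : R) :
  sums_to (fun j => large_part theta b j / j%:R) lam ->
  is_lim_seq (fun n => n%:R * hmean (large_part theta b) n / theta n) (exp lam).
Proof.
have l0 j : (0 < j)%N -> 0 <= large_part theta b j.
  by move/(large_part_bounds b); case/andP.
move=> /(hmean_sums l0) hl; have := renewal_limit b _ hl.
move=> H; apply: is_lim_seq_ext (H _) => [n|m].
  by rewrite hmean_rec mulr_suml.
by rewrite hmean_ge0 //= hmean_large_part_le.
Qed.

Lemma large_part_sums b (lam : R) : sums_to (fun j => theta j / j%:R) lam ->
  sums_to (fun j => large_part theta b j / j%:R)
    (lam - \sum_(1 <= j < b.+1) theta j / j%:R).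
Proof.
move=> tl; set s := \sum_(_ <= _ < _) _.
have := is_lim_seq_minus' _ _ _ _ tl (is_lim_seq_const s).
apply: (@lim_ext b.+1) => n bn; rewrite RminusE.
rewrite -(big_mkord predT (fun j => theta j / j%:R)).
rewrite -(big_mkord predT (fun j => large_part theta b j / j%:R)).
rewrite [in LHS](big_cat_nat (n := b.+1)) //= [in RHS](big_cat_nat (n := b.+1)) //=.
have -> : \sum_(0 <= j < b.+1) theta j / j%:R = s.
  by rewrite (big_ltn (m := 0)) // invr0 mulr0 add0r.
rewrite addrAC subrr add0r.
rewrite [X in _ = X + _]big_nat [X in _ = X + _]big1 ?add0r; last first.
  by move=> j /andP [_ jb]; rewrite /large_part -ltnS jb mul0r.
by apply: eq_big_nat => j /andP [bj _]; rewrite /large_part leqNgt bj.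
Qed.

(** The common factor [n / theta n] cancels against the asymptotics of [hmean theta n]. *)
Lemma hmean_quotient (g : nat -> R) (l lam : R) :
  sums_to (fun j => theta j / j%:R) lam ->
  is_lim_seq (fun n => n%:R * g n / theta n) l ->
  is_lim_seq (fun n => g n / hmean theta n) (l / exp lam)%R.
Proof.
move=> tl gl; have e0 : exp lam <> 0 by apply/eqP; rewrite gt_eqF //; apply/RltP/exp_pos.
have := is_lim_seq_div' _ _ _ _ gl (hmean_asymp tl) e0.
apply: (@lim_ext 1) => n n0; rewrite RdivE.
have h0 : hmean theta n != 0 by rewrite gt_eqF // hmean_gt0.
have t0 : theta n != 0 by rewrite gt_eqF // theta_gt0.
have n0' : n%:R != 0 :> R by rewrite pnatr_eq0 -lt0n.
by field; rewrite h0 t0 n0'.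
Qed.

(** Discarding a fixed number [M] of points changes neither [n] nor [theta n] asymptotically. This
    absorbs the points lying in prescribed short cycles. *)
Lemma shift_asymp (g : nat -> R) (l : R) M :
  is_lim_seq (fun n => n%:R * g n / theta n) l ->
  is_lim_seq (fun n => n%:R * g (n - M)%N / theta n) l.
Proof.
move=> gl; apply/(lim_shift M).
have q : is_lim_seq (fun n => (n + M)%N%:R / n%:R) (1 : R).
  have := is_lim_seq_plus' _ _ _ _ (is_lim_seq_const 1)
    (is_lim_seq_mult' _ _ _ _ (is_lim_seq_const M%:R) lim_inv_nat).
  rewrite (_ : Rplus 1 _ = 1); last by rewrite RplusE RmultE mulr0 addr0.
  apply: (@lim_ext 1) => n n0; rewrite RplusE RmultE natrD mulrDl divff //.
  by rewrite pnatr_eq0 -lt0n.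
have := is_lim_seq_mult' _ _ _ _ (is_lim_seq_mult' _ _ _ _ gl q)
  ((lim_shift M _ _).1 (ratio_shift M)).
rewrite (_ : Rmult (Rmult l 1) 1 = l); last by rewrite !RmultE !mulr1.
apply: (@lim_ext 1) => n n0; rewrite !RmultE !addnK.
have t0 : theta n != 0 by rewrite gt_eqF // theta_gt0.
have t1 : theta (n + M)%N != 0 by rewrite gt_eqF // theta_gt0 // ltn_addr.
have n0' : n%:R != 0 :> R by rewrite pnatr_eq0 -lt0n.
by field; rewrite t0 t1 n0'.
Qed.
End Asymptotics.

(** * Limit laws *)

Section LimitLaws.
Local Open Scope ring_scope.

Lemma exp_sum (I : Type) (s : seq I) (f : I -> R) :
  exp (\sum_(i <- s) f i) = \prod_(i <- s) exp (f i).
Proof.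
elim: s => [|i s IH]; first by rewrite !big_nil exp_0.
by rewrite !big_cons -IH expRD.
Qed.

Lemma poisson_prod (theta : nat -> R) b k :
  Rprod_seq (iota 1 b) (fun j => poisson (Rdiv (theta j) (INR j)) (k j)) =
  small_coef theta b k * exp (- \sum_(1 <= j < b.+1) theta j / j%:R)%R.
Proof.
rewrite Rprod_seqE -sumrN exp_sum /small_coef -big_split /index_iota subn1 /=.
apply: eq_bigr => j _.
by rewrite /poisson !RealsE -mulrA mulrC.
Qed.

Variables (theta c : nat -> R).
Hypothesis theta_gt0 : forall j, (0 < j)%N -> 0 < theta j.
Variable C : R.
Hypothesis c_sums : sums_to (fun j => c j / j%:R) C.
Hypothesis theta_bound : forall n j, (0 < j)%N -> (j.*2 <= n)%N ->
  theta (n - j)%N * theta j <= c j * theta n.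
Hypothesis ratio : is_lim_seq (fun n => theta n.+1 / theta n) (1 : R).
Variable lam : R.
Hypothesis lam_sums : sums_to (fun j => theta j / j%:R) lam.

Lemma L1_limit m :
  is_lim_seq (fun n => Pn theta (fun s : 'S_n => L1 s == n - m)%N)
    (hmean theta m / exp lam)%R.
Proof.
have e0 : exp lam <> 0 by apply/eqP; rewrite gt_eqF //; apply/RltP/exp_pos.
have := is_lim_seq_div' _ _ _ _
  (is_lim_seq_mult' _ _ _ _ (ratio_shift theta_gt0 ratio m) (is_lim_seq_const (hmean theta m)))
  (hmean_asymp theta_gt0 c_sums theta_bound ratio lam_sums) e0.
rewrite (_ : Rdiv (Rmult 1 _) _ = hmean theta m / exp lam); last by rewrite RdivE RmultE mul1r.
apply: (@lim_ext m.+1) => n mn; rewrite Pn_L1 // RdivE RmultE.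
have n0 : (0 < n)%N by apply: leq_ltn_trans mn.
have h0 : hmean theta n != 0 by rewrite gt_eqF // hmean_gt0.
have t0 : theta n != 0 by rewrite gt_eqF // theta_gt0.
have n0' : n%:R != 0 :> R by rewrite pnatr_eq0 -lt0n.
by field; rewrite h0 t0 n0'.
Qed.

Lemma Rvec_limit b k :
  is_lim_seq (fun n => Pn theta (@Rvec_event n b k))
    (Rprod_seq (iota 1 b) (fun j => poisson (Rdiv (theta j) (INR j)) (k j))).
Proof.
have ll := large_part_sums (b := b) lam_sums.
have ga := hmean_large_part_asymp theta_gt0 c_sums theta_bound ratio ll.
have := hmean_quotient theta_gt0 c_sums theta_bound ratio lam_sums
  (shift_asymp theta_gt0 ratio (small_size b k) ga).
move=> /(is_lim_seq_mult' _ _ _ _ (is_lim_seq_const (small_coef theta b k))).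
rewrite poisson_prod (_ : Rmult _ _ = small_coef theta b k * exp (- \sum_(1 <= j < b.+1) theta j / j%:R)%R).
  apply: (@lim_ext (small_size b k)) => n Mn.
  by rewrite RmultE Pn_small_event Mn mulrA.
(* [exp (lam - s) / exp lam = exp (- s)], with [s] the sum of [theta j / j] over [j <= b]. *)
rewrite RmultE -expRD [X in X / _]mulrC mulfK //.
by rewrite gt_eqF //; apply/RltP/exp_pos.
Qed.

Lemma Kcyc_limit k :
  is_lim_seq (fun n => Pn theta (fun s : 'S_n => Kcyc s == k.+1)) (poisson lam k).
Proof.
have ka := kmean_asymp theta_gt0 c_sums theta_bound ratio (k := k) lam_sums.
have := hmean_quotient theta_gt0 c_sums theta_bound ratio lam_sums ka.
rewrite (_ : _ / _ / _ = poisson lam k).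
  by apply: is_lim_seq_ext => n; rewrite Pn_Kcyc.
by rewrite /poisson exp_Ropp !RealsE [LHS]mulrC mulrA.
Qed.
End LimitLaws.

Theorem theorem7p1 (theta c : nat -> R)
  (Htheta_pos : forall n : nat, 1 <= n -> Rlt R0 (theta n))
  (Hc_sum : exists l : R,
      infinite_sum (fun i : nat => Rdiv (c i.+1) (INR i.+1)) l)
  (Hc_bound : forall n j : nat, 1 <= j -> j.*2 <= n ->
      Rlt (Rdiv (Rmult (theta (n - j)) (theta j)) (theta n)) (c j))
  (Hratio : Un_cv (fun n : nat => Rdiv (theta n.+1) (theta n)) R1) :
  (exists S : R,
      infinite_sum (hseq theta) S /\
      forall m : nat,
        Un_cv (fun n : nat => Pn theta (fun s : 'S_n => L1 s == n - m))
              (Rdiv (hseq theta m) S))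
  /\ (forall (b : nat) (k : nat -> nat),
        Un_cv (fun n : nat => Pn theta (@Rvec_event n b k))
              (Rprod_seq (iota 1 b)
                 (fun j => poisson (Rdiv (theta j) (INR j)) (k j))))
  /\ (exists lambda : R,
        infinite_sum (fun i : nat => Rdiv (theta i.+1) (INR i.+1)) lambda /\
        forall k : nat,
          Un_cv (fun n : nat => Pn theta (fun s : 'S_n => Kcyc s == k.+1))
                (poisson lambda k)).
Proof.
have theta_gt0 j : 0 < j -> (0 < theta j)%R by move/Htheta_pos/RltP.
have [C /sums_to_infinite_sum HC] := Hc_sum.
have c_sums : sums_to (fun j => c j / j%:R)%R C.
  (* The series is reindexed from 0; the extra term is 0 since [0^-1 = 0]. *)
  apply: sums_to_unshift; last by rewrite invr0 mulr0.
  by apply: sums_to_ext HC => i; rewrite RdivE INRE.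
have theta_bound n j : 0 < j -> j.*2 <= n -> (theta (n - j)%N * theta j <= c j * theta n)%R.
  move=> j0 jn; rewrite -ler_pdivrMr; last by apply: theta_gt0; lia.
  by apply/ltW/RltP; apply: Hc_bound.
have ratio : is_lim_seq (fun n => theta n.+1 / theta n)%R (1 : R)%R.
  exact/is_lim_seq_Reals.
have [lam lam_sums] := theta_div_sums theta_gt0 c_sums theta_bound ratio.
have theta_ge0 j : 0 < j -> (0 <= theta j)%R by move/theta_gt0/ltW.
(* The total mass of all [h_n] is [exp lam], where [lam] is also the Poisson mean for [K - 1]. *)
split; [exists (exp lam); split|split; last (exists lam; split)].
- apply/sums_to_infinite_sum; apply: sums_to_ext (hmean_sums theta_ge0 lam_sums).
  by move=> n; rewrite hseqE.
- move=> m; apply/is_lim_seq_Reals; rewrite hseqE.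
  exact: (L1_limit theta_gt0 c_sums theta_bound ratio lam_sums).
- move=> b k; apply/is_lim_seq_Reals.
  exact: (Rvec_limit theta_gt0 c_sums theta_bound ratio lam_sums).
- apply/sums_to_infinite_sum; apply: sums_to_ext (sums_to_shift lam_sums _).
    by move=> i; rewrite RdivE INRE.
  by rewrite invr0 mulr0.
- move=> k; apply/is_lim_seq_Reals.
  exact: (Kcyc_limit theta_gt0 c_sums theta_bound ratio lam_sums).
Qed.
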